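(* Let $(\Omega,\mathcal F)$ be a measurable space, let $\mathcal C\subset\mathcal F$ be a sub-$\sigma$-algebra, and let $\rho:\mathbb F\to\mathbb R$ be a sublinear operator which is continuous from above on $\mathcal F$. Let $\xi\in\mathbb F$ and let $M>0$ be a constant with $\sup|\xi|\le M$. Then there exists $\hat\eta\in\mathbb G$ such that $$\rho\big((\xi-\hat\eta)^2\big)=\inf_{\eta\in\mathbb C}\rho\big((\xi-\eta)^2\big).$$
   Context: $\mathbb F$ denotes the set of all bounded $\mathcal F$-measurable real functions on $\Omega$, $\mathbb C$ the set of all bounded $\mathcal C$-measurable real functions, and $\mathbb G$ the set of all $\mathcal C$-measurable functions bounded by $M$ (i.e. with values in $[-M,M]$). A sublinear operator is a functional $\rho:\mathbb F\to\mathbb R$ such that: (i) $\rho(\xi_1)\ge\rho(\xi_2)$ if $\xi_1\ge\xi_2$; (ii) $\rho(c)=c$ for $c\in\mathbb R$; (iii) $\rho(\xi_1+\xi_2)\le\rho(\xi_1)+\rho(\xi_2)$ for all $\xi_1,\xi_2\in\mathbb F$; (iv) $\rho(\lambda\xi)=\lambda\rho(\xi)$ for $\lambda\ge0$. $\rho$ is continuous from above on $\mathcal F$ if for each sequence $(\xi_n)\subset\mathbb F$ with $\xi_n\downarrow0$ (pointwise) one has $\rho(\xi_n)\downarrow0$. *)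

(* Defs.v *)
From HB Require Import structures.
From mathcomp Require Import all_boot all_order all_algebra.
From mathcomp Require Import all_classical all_reals all_analysis.

Set Implicit Arguments.
Unset Strict Implicit.
Unset Printing Implicit Defensive.

Import Order.TTheory GRing.Theory Num.Theory.
Import numFieldNormedType.Exports.

Local Open Scope classical_set_scope.
Local Open Scope ring_scope.

Definition is_sub_sigma_algebra (d : measure_display) (Omega : measurableType d)
    (C : set (set Omega)) : Prop :=
  sigma_algebra setT C /\ C `<=` measurable.

Definition bounded_measurable (R : realType) (d : measure_display)
    (Omega : measurableType d) : set (Omega -> R) :=
  [set f : Omega -> R | measurable_fun setT f /\ bounded_fun f].
Arguments bounded_measurable R {d} Omega.

(* [g_sigma_algebraType C] is Omega equipped with the sigma-algebra <<s C >>,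
   which is C itself when C is a sigma-algebra. *)
Definition measurable_wrt (R : realType) (d : measure_display)
    (Omega : measurableType d) (C : set (set Omega)) (f : Omega -> R) : Prop :=
  measurable_fun [set: g_sigma_algebraType C] (f : g_sigma_algebraType C -> R).

Definition bounded_measurable_wrt (R : realType) (d : measure_display)
    (Omega : measurableType d) (C : set (set Omega)) : set (Omega -> R) :=
  [set f : Omega -> R | measurable_wrt C f /\ bounded_fun f].
Arguments bounded_measurable_wrt R {d Omega} C.

Definition measurable_wrt_bounded_by (R : realType) (d : measure_display)
    (Omega : measurableType d) (C : set (set Omega)) (M : R) :
    set (Omega -> R) :=
  [set f : Omega -> R | measurable_wrt C f /\ forall w, f w \in `[- M, M]].

(* A functional on the bounded measurable functions is represented by a total
   function on Omega -> R; only its values on [bounded_measurable R Omega] are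
   constrained or used. *)
Record sublinear_operator (R : realType) (d : measure_display)
    (Omega : measurableType d) (rho : (Omega -> R) -> R) : Prop := {
  sublinear_mono : forall xi1 xi2 : Omega -> R,
    bounded_measurable R Omega xi1 -> bounded_measurable R Omega xi2 ->
    (forall w, xi2 w <= xi1 w) -> rho xi2 <= rho xi1 ;
  sublinear_cst : forall c : R, rho (cst c) = c ;
  sublinear_add : forall xi1 xi2 : Omega -> R,
    bounded_measurable R Omega xi1 -> bounded_measurable R Omega xi2 ->
    rho (xi1 \+ xi2) <= rho xi1 + rho xi2 ;
  sublinear_scale : forall (lambda : R) (xi : Omega -> R),
    bounded_measurable R Omega xi -> 0 <= lambda ->
    rho (fun w => lambda * xi w) = lambda * rho xi
}.

Definition decreases_to0 (R : realType) (u : R^nat) : Prop :=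
  nonincreasing_seq u /\ u @ \oo --> (0 : R).

Definition continuous_from_above (R : realType) (d : measure_display)
    (Omega : measurableType d) (rho : (Omega -> R) -> R) : Prop :=
  forall xi : nat -> Omega -> R,
    (forall n, bounded_measurable R Omega (xi n)) ->
    (forall w, decreases_to0 (fun n => xi n w)) ->
    decreases_to0 (fun n => rho (xi n)).

(* Main.v *)
Require Import Defs.
From HB Require Import structures.
From mathcomp Require Import all_boot all_order all_algebra.
From mathcomp Require Import all_classical all_reals all_analysis.
From mathcomp Require Import measurable_realfun ring lra.

Import Order.TTheory GRing.Theory Num.Theory.
Import numFieldNormedType.Exports.

Local Open Scope classical_set_scope.
Local Open Scope ring_scope.

Set Implicit Arguments.
Unset Strict Implicit.
Unset Printing Implicit Defensive.

(** Call [cost eta = rho ((xi - eta)^2)].  Truncating [eta] to [[-M, M]] does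
    not increase the cost, so near-minimisers may be taken in the set [G] of
    [C]-measurable functions with values in [[-M, M]].  If [rho]
    were a linear expectation, the parallelogram identity would make every
    minimising sequence Cauchy in L^2.  For a sublinear [rho] it does not:
    minimisers need not even be unique, because [rho] is a supremum of linear
    functionals and only some of them notice a given perturbation.

    The cure is one further, additive functional [p] that dominates [rho]
    in the sense of absolute continuity: for functions [f] with values in
    [[0, 1]], [rho f] is small as soon as [p f] is small.  Among
    near-minimisers of the cost one selects those that nearly minimise
    [p (eta^2)].  Near-minimisers form a convex set, so the parallelogram
    identity for [p] shows that the selected ones are close to each other for
    [p], hence for [rho] ([rho_Cauchy_selection]).  A sequence of them with
    summable [rho]-increments converges in [rho] to its pointwise limit
    superior, which is [C]-measurable and [[-M, M]]-valued ([G_complete]), and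
    the cost is continuous for this convergence ([cost_lipschitz]).

    The functional [p] is the weighted sum [\sum_i 2^-i l_i] of additive
    functionals [l_i <= rho] chosen greedily ([greedy_minorants]): at stage [n]
    let [X_n] nearly maximise [rho] among the [[0, 1]]-valued functions on
    which the previous functionals are tiny, and let [l_n] be a minorant with
    [l_n X_n = rho X_n], given by the Hahn-Banach theorem.  Each [l_i] then sees
    [X_n] as a summable sequence, hence vanishes on [Y = limsup X_n]
    (Borel-Cantelli), while [rho (sup_(k >= n) X_k - Y)] tends to 0 by
    continuity from above.  So [rho X_n = l_n X_n] tends to 0
    ([greedy_vanish]), and as [X_n] nearly maximises [rho], this is the
    required domination. *)

(** * The Hahn-Banach theorem on a subset stable under the module operations *)

Record sublinear_on (R : realType) (V : lmodType R) (S : set V) (q : V -> R)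
    : Prop := {
  sublinear_on_add : forall x y, S x -> S y -> q (x + y) <= q x + q y ;
  sublinear_on_scale : forall a x, S x -> 0 <= a -> q (a *: x) = a * q x
}.

Definition lmod_stable (R : realType) (V : lmodType R) (S : set V) : Prop :=
  S 0 /\ forall a x y, S x -> S y -> S (a *: x + y).

Section HahnBanach.
Context {R : realType} {V : lmodType R} {S : set V}.
Hypothesis stableS : lmod_stable S.

Let S0 : S 0. Proof. exact: stableS.1. Qed.

Let SD x y : S x -> S y -> S (x + y).
Proof. by move=> Sx Sy; rewrite -[x]scale1r; exact: stableS.2. Qed.

Let SZ a x : S x -> S (a *: x).
Proof. by move=> Sx; rewrite -[_ *: _]addr0; exact: stableS.2. Qed.

Let SN x : S x -> S (- x).
Proof. by move=> Sx; rewrite -scaleN1r; exact: SZ. Qed.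

Lemma sublinear_on0 q : sublinear_on S q -> q 0 = 0.
Proof.
by move=> hq; rewrite -[X in q X](scale0r 0) (sublinear_on_scale hq)// mul0r.
Qed.

Lemma sublinear_on_oppr q x : sublinear_on S q -> S x -> - q (- x) <= q x.
Proof.
move=> hq Sx; have := sublinear_on_add hq Sx (SN Sx).
rewrite addrN (sublinear_on0 hq); lra.
Qed.

(** With [t = h^-1] this is the limit of [(q (y + h *: x) - q y) / h] as [h]
    decreases to 0: the one-sided derivative of [q] at [y] in the direction
    [x].  It is the largest sublinear minorant of [q] whose value at [- y] is
    [- q y]. *)
Definition straighten (q : V -> R) (y x : V) : R :=
  inf [set q (x + t *: y) - t * q y | t in [set t | 0 <= t]].

Section Straighten.
Context (q : V -> R) (y : V) (hq : sublinear_on S q) (Sy : S y).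

Let lb x t : S x -> 0 <= t -> - q (- x) <= q (x + t *: y) - t * q y.
Proof.
move=> Sx t0; rewrite -(sublinear_on_scale hq)//.
have := sublinear_on_add hq (SD Sx (SZ t Sy)) (SN Sx).
rewrite addrAC addrN add0r; lra.
Qed.

Let straighten_le x t : S x -> 0 <= t ->
  straighten q y x <= q (x + t *: y) - t * q y.
Proof.
move=> Sx t0; apply: ge_inf; last by exists t.
by exists (- q (- x)) => _ [s s0 <-]; exact: lb.
Qed.

Let le_straighten x c :
  (forall t, 0 <= t -> c <= q (x + t *: y) - t * q y) -> c <= straighten q y x.
Proof.
move=> h; apply: lb_le_inf; last by move=> _ [s s0 <-]; exact: h.
by exists (q (x + 0 *: y) - 0 * q y), 0 => //=.
Qed.

Lemma straighten_leq x : S x -> straighten q y x <= q x.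
Proof.
move=> Sx; have := straighten_le Sx (lexx 0).
by rewrite scale0r addr0 mul0r subr0.
Qed.

Lemma straighten_opp : straighten q y (- y) <= - q y.
Proof.
have := straighten_le (SN Sy) ler01.
by rewrite scale1r addNr (sublinear_on0 hq) mul1r add0r.
Qed.

Lemma straighten_sublinear : sublinear_on S (straighten q y).
Proof.
have scale_le a x : S x -> 0 < a ->
    straighten q y (a *: x) <= a * straighten q y x.
  move=> Sx a0; rewrite mulrC -ler_pdivrMr//; apply: le_straighten => t t0.
  rewrite ler_pdivrMr//.
  apply: le_trans (@straighten_le _ (a * t) (SZ a Sx) _) _.
    by rewrite mulr_ge0// ltW.
  rewrite -scalerA -scalerDr (sublinear_on_scale hq) ?(ltW a0)//.
    lra.
  by apply: SD => //; exact: SZ.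
split=> [x1 x2 S1 S2|a x Sx].
  rewrite -lerBlDr; apply: le_straighten => t1 t10.
  rewrite lerBlDr -lerBlDl; apply: le_straighten => t2 t20.
  have := straighten_le (SD S1 S2) (addr_ge0 t10 t20).
  have := sublinear_on_add hq (SD S1 (SZ t1 Sy)) (SD S2 (SZ t2 Sy)).
  rewrite addrACA -scalerDl; lra.
rewrite le_eqVlt => /predU1P[<-|a0].
  rewrite scale0r mul0r; apply/le_anti/andP; split.
    by rewrite -[leRHS](sublinear_on0 hq); exact: straighten_leq.
  apply: le_straighten => t t0.
  by apply: le_trans (lb S0 t0); rewrite oppr0 (sublinear_on0 hq) oppr0.
apply/le_anti/andP; split; first exact: scale_le.
rewrite mulrC -ler_pdivlMr// mulrC -{1}(scale1r x) -(mulVf (lt0r_neq0 a0))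
  -scalerA.
by apply: scale_le; [exact: SZ|rewrite invr_gt0].
Qed.

End Straighten.

(** Zorn's lemma, applied to the pointwise order: the infimum of a chain of
    sublinear functionals is again sublinear, because two members of a chain
    can be bounded by the smaller of them. *)
Lemma minimal_sublinear p : sublinear_on S p ->
  exists l, [/\ sublinear_on S l, forall x, S x -> l x <= p x &
    forall q, sublinear_on S q -> (forall x, S x -> q x <= l x) ->
      forall x, S x -> l x <= q x].
Proof.
move=> hp.
pose T := {q : V -> R | sublinear_on S q /\ forall x, S x -> q x <= p x}.
pose below (s t : T) := `[< forall x, S x -> sval t x <= sval s x >].
pose t0 : T := exist _ p (conj hp (fun x _ => lexx (p x))).
have [s|r s t /asboolP rs /asboolP st|A totA|m hm] := @ZL_preorder T t0 below.
- by apply/asboolP.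
- by apply/asboolP => x Sx; exact: le_trans (st x Sx) (rs x Sx).
- have [[s0 As0]|noA] := pselect (exists s, A s); last first.
    by exists t0 => s As; exfalso; apply: noA; exists s.
  pose q x := inf [set sval s x | s in A].
  have q_le s x : A s -> S x -> q x <= sval s x.
    move=> As Sx; apply: ge_inf; last by exists s.
    exists (- p (- x)) => _ [t At <-].
    apply: le_trans (sublinear_on_oppr (svalP t).1 Sx).
    by rewrite lerN2 (svalP t).2//; exact: SN.
  have le_q c x : (forall s, A s -> c <= sval s x) -> c <= q x.
    move=> h; apply: lb_le_inf; last by move=> _ [s As <-]; exact: h.
    by exists (sval s0 x), s0.
  have q_sub : sublinear_on S q.
    split=> [x y Sx Sy|a x Sx a0].
      rewrite -lerBlDr; apply: (le_q) => s As; rewrite lerBlDr -lerBlDl.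
      apply: (le_q) => t At; rewrite lerBlDr.
      have [/asboolP st|/asboolP ts] := totA _ _ As At.
        have := st x Sx; have := sublinear_on_add (svalP t).1 Sx Sy.
        have := q_le _ _ At (SD Sx Sy); lra.
      have := ts y Sy; have := sublinear_on_add (svalP s).1 Sx Sy.
      have := q_le _ _ As (SD Sx Sy); lra.
    apply/le_anti/andP; split; last first.
      apply: (le_q) => s As; rewrite (sublinear_on_scale (svalP s).1)//.
      by apply: ler_wpM2l => //; exact: (q_le).
    move: a0; rewrite [0 <= a]le_eqVlt => /predU1P[<-|a0].
      rewrite scale0r mul0r.
      by rewrite -(sublinear_on0 (svalP s0).1); exact: (q_le).
    rewrite mulrC -ler_pdivrMr//; apply: (le_q) => s As;
      rewrite ler_pdivrMr// mulrC.
    rewrite -(sublinear_on_scale (svalP s).1) ?(ltW a0)//.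
    by apply: (q_le) => //; exact: SZ.
  have qp x : S x -> q x <= p x.
    by move=> Sx; exact: le_trans (q_le _ _ As0 Sx) ((svalP s0).2 x Sx).
  exists (exist _ q (conj q_sub qp)) => s As.
  by apply/asboolP => x Sx /=; exact: (q_le).
exists (sval m); split; [exact: (svalP m).1|exact: (svalP m).2|].
move=> q hq qm x Sx.
have qp z : S z -> q z <= p z.
  by move=> Sz; exact: le_trans (qm z Sz) ((svalP m).2 z Sz).
have := hm (exist _ q (conj hq qp)).
by move=> /(_ (introT (asboolP _) qm))/asboolP; exact.
Qed.

(** Straightening is used twice: once to force [l x0 = p x0] before
    minimising, and once to see that a minimal functional is odd, hence
    additive. *)
Lemma Hahn_Banach_point p x0 : sublinear_on S p -> S x0 ->
  exists l, [/\ sublinear_on S l, forall x, S x -> l x <= p x,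
    forall x y, S x -> S y -> l (x + y) = l x + l y & l x0 = p x0].
Proof.
move=> hp Sx0.
have [l [hl lp lmin]] := minimal_sublinear (straighten_sublinear hp Sx0).
have lN y : S y -> l (- y) = - l y.
  move=> Sy; apply/le_anti/andP; split.
    apply: le_trans (straighten_opp hl Sy).
    apply: lmin (SN Sy); first exact: straighten_sublinear.
    by move=> x Sx; exact: straighten_leq.
  by rewrite lerNl; apply: sublinear_on_oppr.
have lp' x : S x -> l x <= p x.
  by move=> Sx; apply: le_trans (lp x Sx) _; exact: straighten_leq.
exists l; split => //.
  move=> x y Sx Sy; apply/le_anti/andP; split;
    first exact: (sublinear_on_add hl).
  have := sublinear_on_add hl (SD Sx Sy) (SN Sy).
  rewrite addrK lN//; lra.
apply/le_anti/andP; split; first exact: lp'.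
rewrite -lerN2 -lN//; apply: le_trans (lp _ (SN Sx0)) _.
exact: straighten_opp.
Qed.

End HahnBanach.

(** * Powers of one half *)

Section Half.
Context {R : realType}.
Local Notation half := (2^-1 : R).

Lemma half_gt0 n : 0 < half ^+ n.
Proof. by rewrite exprn_gt0// invr_gt0. Qed.

Lemma half_ge0 n : 0 <= half ^+ n.
Proof. exact/ltW/half_gt0. Qed.

Lemma half_mono m n : (m <= n)%N -> half ^+ n <= half ^+ m.
Proof. by move=> mn; rewrite ler_wiXn2l// ?invr_ge0// invf_le1 ?ler1n. Qed.

Lemma half_cvg : (fun n => half ^+ n) @ \oo --> (0 : R).
Proof. by apply: cvg_expr; rewrite ger0_norm ?invr_ge0// invf_lt1// ltr1n. Qed.

Lemma half_small e : 0 < e -> exists n, half ^+ n <= e.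
Proof.
move=> e0; have /cvgrPdist_le/(_ _ e0)[n _ /(_ n (leqnn n))] := half_cvg.
by rewrite sub0r normrN => /(le_trans (ler_norm _)) small; exists n.
Qed.

Lemma sum_half m N :
  \sum_(k < N) half ^+ (m + k) = 2 * half ^+ m - 2 * half ^+ (m + N).
Proof.
elim: N => [|N IH]; first by rewrite big_ord0 addn0 subrr.
by rewrite big_ord_recr /= IH addnS [half ^+ (m + N).+1]exprS; field.
Qed.

Lemma sum_half_le m N : \sum_(k < N) half ^+ (m + k) <= 2 * half ^+ m.
Proof. by rewrite sum_half gerBl mulr_ge0// half_ge0. Qed.

End Half.

(** * The limit superior of a bounded sequence *)

Section BoundedSequence.
Context {R : realType} {u : nat -> R} {K : R} (uK : forall n, `|u n| <= K).

Lemma bounded_has_ubound : has_ubound (range u).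
Proof.
by exists K => _ [n _ <-]; have := uK n; rewrite ler_norml => /andP[].
Qed.

Lemma bounded_has_lbound : has_lbound (range u).
Proof.
by exists (- K) => _ [n _ <-]; have := uK n; rewrite ler_norml => /andP[].
Qed.

Lemma le_sups n k : (n <= k)%N -> u k <= sups u n.
Proof.
move=> nk; apply: ub_le_sup; last by exists k.
exact/has_ubound_sdrop/bounded_has_ubound.
Qed.

Lemma sups_adherent n e : 0 < e -> exists k, sups u n < u (n + k)%N + e.
Proof.
move=> e0; have [|_ [k /= nk <-] ke] := @sup_adherent R (sdrop u n) e e0.
  split; first by exists (u n), n => /=.
  exact/has_ubound_sdrop/bounded_has_ubound.
by exists (k - n)%N; rewrite subnKC// -ltrBlDr.
Qed.

Lemma sups_norm_le n : `|sups u n| <= K.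
Proof.
rewrite ler_norml; apply/andP; split.
  by apply: le_trans (le_sups (leqnn n)); have := uK n;
    rewrite ler_norml => /andP[].
apply: ge_sup; first by exists (u n), n => /=.
by move=> _ [k _ <-]; have := uK k; rewrite ler_norml => /andP[].
Qed.

Lemma sups_cvg : sups u @ \oo --> limn_sup u.
Proof.
apply/cvg_ex; eexists.
exact: cvg_sups_inf bounded_has_ubound bounded_has_lbound.
Qed.

Lemma sups_decr m n : (m <= n)%N -> sups u n <= sups u m.
Proof. exact: nonincreasing_sups bounded_has_ubound _ _. Qed.

Lemma limn_sup_le_sups n : limn_sup u <= sups u n.
Proof.
apply: nonincreasing_cvgn_ge;
  first exact: nonincreasing_sups bounded_has_ubound.
by apply/cvg_ex; exists (limn_sup u); exact: sups_cvg.
Qed.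

Lemma limn_sup_norm_le : `|limn_sup u| <= K.
Proof.
have cvg_u : cvgn (sups u)
  by apply/cvg_ex; exists (limn_sup u); exact: sups_cvg.
rewrite ler_norml; apply/andP; split.
  apply: limr_ge => //; apply: nearW => n.
  by have := sups_norm_le n; rewrite ler_norml => /andP[].
apply: limr_le => //; apply: nearW => n.
by have := sups_norm_le n; rewrite ler_norml => /andP[].
Qed.

End BoundedSequence.

(** * Bounded measurable functions *)

Lemma bounded_funE (R : realType) (T : Type) (f : T -> R) :
  bounded_fun f <-> exists K, forall w, `|f w| <= K.
Proof.
split=> [[K [_ fK]]|[K fK]].
  by exists (K + 1) => w; apply: fK => //; rewrite ltrDl.
exists K; split; first exact: num_real.
by move=> K' KK' w _; exact: le_trans (fK w) (ltW KK').
Qed.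

Section BoundedMeasurable.
Context {R : realType} {d : measure_display} {Omega : measurableType d}.
Local Notation bm := (bounded_measurable R Omega).

Lemma bm_intro (f : Omega -> R) K :
  measurable_fun setT f -> (forall w, `|f w| <= K) -> bm f.
Proof. by move=> mf fK; split=> //; apply/bounded_funE; exists K. Qed.

Lemma bm_cst (c : R) : bm (fun=> c).
Proof. by apply: (@bm_intro _ `|c|) => //; exact: measurable_cst. Qed.

Lemma bm_add (f g : Omega -> R) : bm f -> bm g -> bm (fun w => f w + g w).
Proof.
move=> [mf /bounded_funE[K fK]] [mg /bounded_funE[L gL]].
apply: (@bm_intro _ (K + L)); first exact: measurable_funD.
by move=> w; rewrite (le_trans (ler_normD _ _))// lerD.
Qed.

Lemma bm_mul (f g : Omega -> R) : bm f -> bm g -> bm (fun w => f w * g w).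
Proof.
move=> [mf /bounded_funE[K fK]] [mg /bounded_funE[L gL]].
apply: (@bm_intro _ (K * L)); first exact: measurable_funM.
by move=> w; rewrite normrM ler_pM.
Qed.

Lemma bm_scale (c : R) (f : Omega -> R) : bm f -> bm (fun w => c * f w).
Proof. by apply: bm_mul; exact: bm_cst. Qed.

Lemma bm_sub (f g : Omega -> R) : bm f -> bm g -> bm (fun w => f w - g w).
Proof.
move=> bf bg; have -> : (fun w => f w - g w) = (fun w => f w + -1 * g w).
  by apply/funext => w; rewrite mulN1r.
by apply: bm_add => //; exact: bm_scale.
Qed.

Lemma bm_sqr (f : Omega -> R) : bm f -> bm (fun w => f w ^+ 2).
Proof.
move=> bf; have -> : (fun w => f w ^+ 2) = (fun w => f w * f w).
  by apply/funext => w; rewrite expr2.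
exact: bm_mul.
Qed.

Lemma bm_max (f g : Omega -> R) :
  bm f -> bm g -> bm (fun w => Num.max (f w) (g w)).
Proof.
move=> [mf /bounded_funE[K fK]] [mg /bounded_funE[L gL]].
apply: (@bm_intro _ (Num.max K L)); first exact: measurable_maxr.
by move=> w; rewrite le_max; case: (leP (f w) (g w)) => _;
  rewrite ?fK ?gL ?orbT.
Qed.

Lemma bm_norm (f : Omega -> R) : bm f -> bm (fun w => `|f w|).
Proof.
move=> [mf /bounded_funE[K fK]]; apply: (@bm_intro _ K).
  exact: measurableT_comp.
by move=> w; rewrite normr_id.
Qed.

Lemma bm_sum (f : nat -> Omega -> R) N :
  (forall k, bm (f k)) -> bm (fun w => \sum_(k < N) f k w).
Proof.
move=> bf; elim: N => [|N IH].
  have -> : (fun w => \sum_(k < 0) f k w) = (fun=> 0).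
    by apply/funext => w; rewrite big_ord0.
  exact: bm_cst.
have -> : (fun w => \sum_(k < N.+1) f k w) =
          (fun w => \sum_(k < N) f k w + f N w).
  by apply/funext => w; rewrite big_ord_recr.
exact: bm_add.
Qed.

Lemma bm_lmod_stable :
  lmod_stable (bounded_measurable R Omega : set (Omega -> R^o)).
Proof.
by split=> [|a x y bx bY]; [exact: bm_cst|apply: bm_add => //; exact: bm_scale].
Qed.

End BoundedMeasurable.

(** * Sublinear operators continuous from above *)

Section SublinearOperator.
Context {R : realType} {d : measure_display} {Omega : measurableType d}.
Local Notation bm := (bounded_measurable R Omega).
Implicit Types (f g : Omega -> R).

Section Basic.
Context {rho : (Omega -> R) -> R} (hrho : sublinear_operator rho).

Lemma rho_add f g : bm f -> bm g -> rho (fun w => f w + g w) <= rho f + rho g.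
Proof. exact: (sublinear_add hrho). Qed.

Lemma rho_ge0 f : bm f -> (forall w, 0 <= f w) -> 0 <= rho f.
Proof.
move=> bf f0; rewrite -(sublinear_cst hrho 0).
by apply: (sublinear_mono hrho) => //; exact: bm_cst.
Qed.

Lemma rho_sum (f : nat -> Omega -> R) N : (forall k, bm (f k)) ->
  rho (fun w => \sum_(k < N) f k w) <= \sum_(k < N) rho (f k).
Proof.
move=> bf; elim: N => [|N IH].
  have -> : (fun w => \sum_(k < 0) f k w) = (cst 0).
    by apply/funext => w; rewrite big_ord0.
  by rewrite (sublinear_cst hrho) big_ord0.
have -> : (fun w => \sum_(k < N.+1) f k w) =
          (fun w => \sum_(k < N) f k w + f N w).
  by apply/funext => w; rewrite big_ord_recr.
rewrite big_ord_recr; apply: le_trans (rho_add _ _) _ => //;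
  first exact: bm_sum.
by rewrite lerD2r.
Qed.

(** The excess [max 0 (Y - \sum_(k < N) X k)] decreases to 0, so continuity
    from above turns finite subadditivity into countable subadditivity.  The
    domination is only asked up to [e], which lets [Y] be a supremum. *)
Lemma rho_countable_subadditive (hcont : continuous_from_above rho)
    (Y : Omega -> R) (X : nat -> Omega -> R) s :
  bm Y -> (forall k, bm (X k)) -> (forall k w, 0 <= X k w) ->
  (forall w e, 0 < e -> exists N, Y w <= \sum_(k < N) X k w + e) ->
  (forall N, \sum_(k < N) rho (X k) <= s) -> rho Y <= s.
Proof.
move=> bY bX X0 YX Xs.
pose Z N w := Num.max 0 (Y w - \sum_(k < N) X k w).
have bZ N : bm (Z N).
  by apply: bm_max; [exact: bm_cst|apply: bm_sub => //; exact: bm_sum].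
have Z_le w m n : (m <= n)%N -> Z n w <= Z m w.
  move=> mn; rewrite /Z; apply: le_max2 => //; rewrite lerB//.
  rewrite -!(big_mkord xpredT (fun k => X k w)) (big_cat_nat (leq0n m) mn)//=.
  by rewrite lerDl sumr_ge0.
have [_ /cvgrPdist_le rhoZ] : decreases_to0 (fun N => rho (Z N)).
  apply: hcont => // w; split; first by move=> m n; exact: Z_le.
  apply/cvgrPdist_le => e e0; have [N YN] := YX w e e0.
  near=> n; rewrite sub0r normrN ger0_norm; last by rewrite /Z le_max lexx.
  apply: (@le_trans _ _ (Z N w)); first by apply: Z_le; near: n;
    exact: nbhs_infty_ge.
  by rewrite /Z ge_max (ltW e0) lerBlDl.
apply/ler_addgt0Pr => e e0; have [N _ /(_ N (leqnn N))] := rhoZ e e0.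
rewrite sub0r normrN => /(le_trans (ler_norm _)) ZN.
have YZ : rho Y <= rho (fun w => \sum_(k < N) X k w + Z N w).
  apply: (sublinear_mono hrho) => //; first by apply: bm_add => //;
    exact: bm_sum.
  by move=> w; rewrite -lerBlDl /Z le_max lexx orbT.
apply: (le_trans YZ); apply: le_trans (rho_add _ _) _ => //;
  first exact: bm_sum.
by rewrite lerD// (le_trans (rho_sum _ _)).
Unshelve. all: by end_near. Qed.

End Basic.

(** * Additive minorants *)

Record additive_minorant (rho l : (Omega -> R) -> R) : Prop := {
  minorant_le : forall f, bm f -> l f <= rho f ;
  minorant_add : forall f g, bm f -> bm g ->
    l (fun w => f w + g w) = l f + l g ;
  minorant_scale : forall a f, bm f -> 0 <= a -> l (fun w => a * f w) = a * l f
}.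

Section Minorant.
Context {rho : (Omega -> R) -> R} (hrho : sublinear_operator rho).

Lemma exists_minorant f : bm f ->
  exists2 l, additive_minorant rho l & l f = rho f.
Proof.
move=> bf.
have hp : sublinear_on (bounded_measurable R Omega : set (Omega -> R^o)) rho.
  split; [exact: (sublinear_add hrho)|exact: (sublinear_scale hrho)].
have [l [hl lrho lD lf]] := Hahn_Banach_point bm_lmod_stable hp bf.
exists l => //; split => //; exact: (sublinear_on_scale hl).
Qed.

Context (l : (Omega -> R) -> R) (hl : additive_minorant rho l).

Lemma minorant0 : l (cst 0) = 0.
Proof.
have -> : (cst 0 : Omega -> R) = (fun w => 0 * cst 0 w).
  by apply/funext => w; rewrite mul0r.
by rewrite (minorant_scale hl) ?mul0r//; exact: bm_cst.
Qed.

Lemma minorant_sub f g : bm f -> bm g -> l (fun w => f w - g w) = l f - l g.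
Proof.
move=> bf bg; apply/eqP; rewrite eq_sym subr_eq; apply/eqP.
rewrite -(minorant_add hl) ?bm_sub//; first by congr l; apply/funext => w;
  rewrite subrK.
exact: bm_sub.
Qed.

Lemma minorant_mono f g : bm f -> bm g -> (forall w, g w <= f w) -> l g <= l f.
Proof.
move=> bf bg gf; rewrite -subr_le0 -minorant_sub//.
apply: le_trans (minorant_le hl (bm_sub bg bf)) _.
rewrite -(sublinear_cst hrho 0); apply: (sublinear_mono hrho).
- exact: bm_cst.
- exact: bm_sub.
- by move=> w; rewrite subr_le0.
Qed.

Lemma minorant_ge0 f : bm f -> (forall w, 0 <= f w) -> 0 <= l f.
Proof.
by move=> bf f0; rewrite -minorant0; apply: minorant_mono => //; exact: bm_cst.
Qed.

(** Additive minorants inherit both properties of [rho], so that countable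
    subadditivity applies to them as well. *)
Lemma minorant_sublinear : sublinear_operator l.
Proof.
split.
- by move=> f g bf bg; exact: minorant_mono.
- move=> c; apply/le_anti/andP; split.
    by rewrite -[leRHS](sublinear_cst hrho); exact: (minorant_le hl (bm_cst c)).
  have /(_ (bm_cst 0) (bm_cst c)) := @minorant_sub (cst 0) (cst c).
  rewrite minorant0 sub0r => lc; rewrite -lerN2 -lc
    -[leRHS](sublinear_cst hrho).
  have -> : (fun w => cst 0 w - cst c w) = (cst (- c) : Omega -> R).
    by apply/funext => w; rewrite /= sub0r.
  exact: (minorant_le hl (bm_cst _)).
- by move=> f g bf bg; rewrite -(minorant_add hl).
- by move=> a f bf a0; exact: (minorant_scale hl).
Qed.

Lemma minorant_continuous :
  continuous_from_above rho -> continuous_from_above l.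
Proof.
move=> hcont X bX dX; have [_ rhoX] := hcont X bX dX.
have X0 n w : 0 <= X n w.
  have [Xdec Xcvg] := dX w; have <- := cvg_lim (@Rhausdorff R) Xcvg.
  by apply: (nonincreasing_cvgn_ge Xdec); apply/cvg_ex; exists 0.
split.
  by move=> m n mn; apply: minorant_mono => // w; exact: (dX w).1.
apply: (squeeze_cvgr _ (cvg_cst 0) rhoX).
by apply: nearW => n; rewrite minorant_ge0//= (minorant_le hl).
Qed.

End Minorant.

(** * A control functional *)

Definition unit_valued f : Prop := bm f /\ forall w, 0 <= f w <= 1.

(** An additive functional with respect to which [rho] is absolutely
    continuous ([control_small]).  All clauses concern nonnegative functions
    because [p] arises as a monotone limit, which exists on those. *)
Record control (rho p : (Omega -> R) -> R) : Prop := {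
  control_add : forall f g, bm f -> bm g -> (forall w, 0 <= f w) ->
    (forall w, 0 <= g w) -> p (fun w => f w + g w) = p f + p g ;
  control_scale : forall a f, bm f -> (forall w, 0 <= f w) -> 0 <= a ->
    p (fun w => a * f w) = a * p f ;
  control_ge0 : forall f, bm f -> (forall w, 0 <= f w) -> 0 <= p f ;
  control_le : forall f, bm f -> (forall w, 0 <= f w) -> p f <= 2 * rho f ;
  control_small : forall e, 0 < e -> exists2 del, 0 < del &
    forall f, unit_valued f -> p f <= del -> rho f <= e
}.

Section Control.
Context {rho : (Omega -> R) -> R} (hrho : sublinear_operator rho).
Hypothesis hcont : continuous_from_above rho.

Local Notation half := (2^-1 : R).

Definition partial_control (l : nat -> (Omega -> R) -> R) n f : R :=
  \sum_(i < n) half ^+ i * l i f.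

(** The threshold [half ^+ (n + n)] beats the weight [half ^+ i] of each earlier
    minorant: dividing by it still leaves [l i (X n) <= half ^+ n], a summable
    bound. *)
Lemma greedy_minorants : exists l X, forall n,
  [/\ additive_minorant rho (l n), unit_valued (X n), l n (X n) = rho (X n),
    partial_control l n (X n) <= half ^+ (n + n) &
    forall f, unit_valued f -> partial_control l n f <= half ^+ (n + n) ->
      rho f <= rho (X n) + half ^+ n].
Proof.
(* The functional [np.2] stands for the weighted sum of the minorants chosen so
   far; the guard [np.2 (cst 0) = 0] makes 0 an admissible competitor. *)
have step (np : nat * ((Omega -> R) -> R)) :
    exists lX : ((Omega -> R) -> R) * (Omega -> R), np.2 (cst 0) = 0 ->
    [/\ additive_minorant rho lX.1, unit_valued lX.2, lX.1 lX.2 = rho lX.2,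
      np.2 lX.2 <= half ^+ (np.1 + np.1) &
      forall f, unit_valued f -> np.2 f <= half ^+ (np.1 + np.1) ->
        rho f <= rho lX.2 + half ^+ np.1].
  case: np => n p /=; have [p0|p0] := pselect (p (cst 0) = 0); last first.
    by exists (p, cst 0) => /p0.
  pose adm :=
    [set rho f | f in [set f | unit_valued f /\ p f <= half ^+ (n + n)]].
  have unit0 : unit_valued (cst 0) by
    split; [exact: bm_cst|move=> w /=; rewrite lexx ler01].
  have adm_sup : has_sup adm.
    split; first by exists (rho (cst 0)), (cst 0) => //=; rewrite p0 half_ge0.
    exists 1 => _ [f [[bf f01] _] <-]; rewrite -(sublinear_cst hrho 1).
    by apply: (sublinear_mono hrho) => //; [exact: bm_cst|move=> w;
      case/andP: (f01 w)].
  have [_ [f [uf pf] <-] fsup] := sup_adherent (half_gt0 n) adm_sup.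
  have [l hl lf] := exists_minorant hrho uf.1.
  exists (l, f) => _; split => //= g ug pg.
  rewrite -lerBlDr (le_trans _ (ltW fsup))// lerB//.
  by apply: (ub_le_sup adm_sup.2); exists g.
have [F FP] := choice step.
pose p := fix p n : (Omega -> R) -> R :=
  if n is m.+1 then fun f => p m f + half ^+ m * (F (m, p m)).1 f else fun=> 0.
pose l n := (F (n, p n)).1.
have pE n f : p n f = partial_control l n f.
  rewrite /partial_control; elim: n => [|n IH]; first by rewrite big_ord0.
  by rewrite big_ord_recr /= IH.
have p0 n : p n (cst 0) = 0.
  elim: n => [//|n IH] /=; rewrite IH add0r.
  by have [hl _ _ _ _] := FP (n, p n) IH; rewrite (minorant0 hl) mulr0.
exists l, (fun n => (F (n, p n)).2) => n.
have [hl uX lX pX maxX] := FP (n, p n) (p0 n).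
split => //; first by rewrite -pE.
by move=> f uf; rewrite -pE; exact: maxX.
Qed.

Section Greedy.
Context (l : nat -> (Omega -> R) -> R) (X : nat -> Omega -> R).
Hypothesis hl : forall n, additive_minorant rho (l n).
Hypothesis uX : forall n, unit_valued (X n).
Hypothesis lX : forall n, partial_control l n (X n) <= half ^+ (n + n).

Let l_ge0 i f : unit_valued f -> 0 <= l i f.
Proof.
by move=> [bf f01]; apply: (minorant_ge0 hrho (hl i)) => // w;
  case/andP: (f01 w).
Qed.

Let l_small i n : (i < n)%N -> l i (X n) <= half ^+ n.
Proof.
move=> lin; have term_ge0 (j : 'I_n) : 0 <= half ^+ j * l j (X n).
  by rewrite mulr_ge0 ?half_ge0 ?l_ge0.
have : half ^+ i * l i (X n) <= half ^+ (n + n).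
  apply: le_trans (lX n); rewrite /partial_control (bigD1 (Ordinal lin))//=.
  by rewrite lerDl sumr_ge0.
rewrite exprD => h.
rewrite -(ler_pM2l (half_gt0 i)) (le_trans h)// ler_wpM2r ?half_ge0//.
by rewrite half_mono// ltnW.
Qed.

Let tail n w : R := sups (X ^~ w) n.
Let limsup w : R := limn_sup (X ^~ w).

Let X1 w n : `|X n w| <= 1.
Proof. by have /andP[X0 X1] := (uX n).2 w; rewrite ger0_norm. Qed.

Let bm_tail n : bm (tail n).
Proof.
apply: (@bm_intro _ _ _ _ 1); last by move=> w; exact: sups_norm_le (X1 w) n.
apply: measurable_fun_sups => [w _|m]; last exact: (uX m).1.1.
exact: bounded_has_ubound (X1 w).
Qed.

Let bm_limsup : bm limsup.
Proof.
apply: (@bm_intro _ _ _ _ 1); last by move=> w; exact: limn_sup_norm_le (X1 w).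
apply: measurable_fun_limn_sup => [w _|w _|m]; last exact: (uX m).1.1.
- exact: bounded_has_ubound (X1 w).
- exact: bounded_has_lbound (X1 w).
Qed.

(** Borel-Cantelli: the values [l i (X k)] with [i < k] are summable, so those
    of the tail suprema tend to 0. *)
Let l_limsup i : l i limsup <= 0.
Proof.
apply/ler_addgt0Pr => e e0; rewrite add0r.
have [m mP] := half_small (divr_gt0 e0 (ltr0Sn R 1)).
set n := maxn m i.+1.
have small : 2 * half ^+ n <= e.
  by rewrite mulrC -ler_pdivlMr// (le_trans _ mP)// half_mono// leq_maxl.
apply: (@rho_countable_subadditive _ (minorant_sublinear hrho (hl i))
  (minorant_continuous hrho (hl i) hcont) _ (fun k => X (n + k))) => //.
- by move=> k; exact: (uX _).1.
- by move=> k w; case/andP: ((uX (n + k)).2 w).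
- move=> w r r0; have [k tk] := sups_adherent (X1 w) n r0; exists k.+1.
  apply: (le_trans (limn_sup_le_sups (X1 w) n)); apply: (le_trans (ltW tk)).
  rewrite lerD2r big_ord_recr /= lerDr sumr_ge0// => j _.
  by case/andP: ((uX (n + j)).2 w).
move=> N; apply: le_trans small.
apply: (@le_trans _ _ (\sum_(k < N) half ^+ (n + k))).
  apply: ler_sum => k _; apply: l_small.
  by rewrite (leq_trans (leq_maxr m i.+1))// leq_addr.
exact: sum_half_le.
Qed.

(** The value [rho (X n) = l n (X n)] is at most [l n (tail n)], which equals
    [l n (tail n - limsup)] up to the null term [l n limsup]; continuity of
    [rho] from above bounds the former uniformly in the minorant. *)
Lemma greedy_vanish : (forall n, l n (X n) = rho (X n)) ->
  (fun n => rho (X n)) @ \oo --> (0 : R).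
Proof.
move=> lXn.
have [|w|_ rhoT] := @hcont (fun n w => tail n w - limsup w).
- by move=> n; exact: bm_sub.
- split; first by move=> m n mn; rewrite lerB//; exact: sups_decr (X1 w) _ _ mn.
  rewrite -(subrr (limsup w)); apply: cvgB; last exact: cvg_cst.
  exact: sups_cvg (X1 w).
apply: (squeeze_cvgr _ (cvg_cst 0) rhoT).
apply: nearW => n; rewrite rho_ge0//=; [|exact: (uX n).1|].
  rewrite -lXn; apply: le_trans (minorant_le (hl n) (bm_sub (bm_tail n)
    bm_limsup)).
  rewrite (minorant_sub (hl n))//.
  apply: (@le_trans _ _ (l n (tail n))); last by rewrite lerBrDr gerDl l_limsup.
  apply: (minorant_mono hrho (hl n)) => //; first exact: (uX n).1.
  by move=> w; exact: le_sups (X1 w) _ _ (leqnn n).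
by move=> w; case/andP: ((uX n).2 w).
Qed.

End Greedy.

(** A function on which [p] is at most [half ^+ (n + n)] competes with [X n], so
    its [rho]-value is at most [rho (X n) + half ^+ n], which vanishes with
    [n]. *)
Lemma exists_control : exists p, control rho p.
Proof.
have [l [X lX]] := greedy_minorants.
have hl n : additive_minorant rho (l n) by have [] := lX n.
have l0 n f : bm f -> (forall w, 0 <= f w) -> 0 <= l n f.
  exact: (minorant_ge0 hrho (hl n)).
have pc_mono f : bm f -> (forall w, 0 <= f w) ->
    nondecreasing_seq (fun n => partial_control l n f).
  move=> bf f0; apply/nondecreasing_seqP => n.
  by rewrite /partial_control big_ord_recr /= lerDl mulr_ge0 ?half_ge0 ?l0.
have pc_le f n : bm f -> (forall w, 0 <= f w) ->
    partial_control l n f <= 2 * rho f.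
  move=> bf f0.
  apply: (@le_trans _ _ (\sum_(i < n) half ^+ (0 + i) * rho f)).
    apply: ler_sum => i _; rewrite add0n ler_wpM2l ?half_ge0//.
    exact: (minorant_le (hl i)).
  rewrite -mulr_suml ler_wpM2r ?rho_ge0//.
  by rewrite (le_trans (sum_half_le _ _))// expr0 mulr1.
have pc_cvg f : bm f -> (forall w, 0 <= f w) ->
    cvgn (fun n => partial_control l n f).
  move=> bf f0; apply: nondecreasing_is_cvgn; first exact: pc_mono.
  by exists (2 * rho f) => _ [n _ <-]; exact: pc_le.
pose p f := limn (fun n => partial_control l n f).
exists p; split.
- move=> f g bf bg f0 g0.
  apply/cvg_lim; first exact: Rhausdorff.
  have -> : (fun n => partial_control l n (fun w => f w + g w)) =
            (fun n => partial_control l n f + partial_control l n g).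
    apply/funext => n; rewrite /partial_control -big_split /=.
    by apply: eq_bigr => i _; rewrite (minorant_add (hl i))// mulrDr.
  by apply: cvgD; exact: pc_cvg.
- move=> a f bf f0 a0.
  apply/cvg_lim; first exact: Rhausdorff.
  have -> : (fun n => partial_control l n (fun w => a * f w)) =
            (fun n => a * partial_control l n f).
    apply/funext => n; rewrite /partial_control mulr_sumr;
      apply: eq_bigr => i _.
    by rewrite (minorant_scale (hl i))// mulrCA.
  by apply: cvgMr; exact: pc_cvg.
- move=> f bf f0; apply: limr_ge; first exact: pc_cvg.
  by apply: nearW => n; rewrite /partial_control sumr_ge0// => i _;
    rewrite mulr_ge0 ?half_ge0 ?l0.
- move=> f bf f0; apply: limr_le; first exact: pc_cvg.
  by apply: nearW => n; exact: pc_le.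
move=> e e0.
have cvg_sum : (fun n => rho (X n) + half ^+ n) @ \oo --> (0 : R).
  rewrite -[X in _ --> X](addr0 0); apply: cvgD.
    by apply: (@greedy_vanish l) => // n; have [] := lX n.
  exact: half_cvg.
have /cvgrPdist_le/(_ _ e0)[n _ /(_ n (leqnn n))] := cvg_sum.
rewrite sub0r normrN => /(le_trans (ler_norm _)) small.
exists (half ^+ (n + n)); first exact: half_gt0.
move=> f uf pf; apply: le_trans small; have [_ _ _ _] := lX n; apply => //.
have [bf f01] := uf; have f0 w : 0 <= f w by case/andP: (f01 w).
by apply: le_trans pf; apply: nondecreasing_cvgn_le;
  [exact: pc_mono|exact: pc_cvg].
Qed.

End Control.

End SublinearOperator.

(** * Near-minimisers and their limit *)

Section Minimiser.
Context {R : realType} {d : measure_display} {Omega : measurableType d}.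
Context {C : set (set Omega)} (hC : is_sub_sigma_algebra C).
Context {rho : (Omega -> R) -> R} (hrho : sublinear_operator rho).
Hypothesis hcont : continuous_from_above rho.
Context {M : R}.
Hypothesis M_gt0 : 0 < M.
Implicit Types (a b : Omega -> R).
Local Notation bm := (bounded_measurable R Omega).
Local Notation G := (measurable_wrt_bounded_by C M).
Local Notation half := (2^-1 : R).

Lemma measurable_wrt_sub a : measurable_wrt C a -> measurable_fun setT a.
Proof.
move=> ma _ B mB; have := ma measurableT B mB.
move=> /=; rewrite /measurable /= (sigma_algebra_id hC.1); exact: hC.2.
Qed.

Lemma G_norm a w : G a -> `|a w| <= M.
Proof. by move=> [_ /(_ w)]; rewrite in_itv /= ler_norml. Qed.

Lemma G_intro a : measurable_wrt C a -> (forall w, `|a w| <= M) -> G a.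
Proof. by move=> ma aM; split=> // w; rewrite in_itv /= -ler_norml. Qed.

Lemma G_bm a : G a -> bm a.
Proof.
move=> Ga; apply: (@bm_intro _ _ _ _ M); first exact: (measurable_wrt_sub Ga.1).
by move=> w; exact: G_norm.
Qed.

Lemma G_mid a b : G a -> G b -> G (fun w => half * (a w + b w)).
Proof.
move=> Ga Gb; apply: G_intro.
  apply: measurable_funM; first exact: measurable_cst.
  by apply: measurable_funD; [exact: Ga.1|exact: Gb.1].
move=> w; have := G_norm w Ga; have := G_norm w Gb; rewrite !ler_norml; lra.
Qed.

(** Since [rho `|zeta k - zeta k.+1|] is summable, countable subadditivity
    compares [zeta n] with any pointwise cluster point of the sequence; the
    limit superior is a [C]-measurable one. *)
Lemma G_complete (zeta : nat -> Omega -> R) : (forall n, G (zeta n)) ->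
  (forall n, rho (fun w => `|zeta n w - zeta n.+1 w|) <= half ^+ n) ->
  exists2 eta, G eta &
    forall n, rho (fun w => `|zeta n w - eta w|) <= 2 * half ^+ n.
Proof.
move=> Gz dz; pose eta w := limn_sup (fun n => zeta n w).
have zM w n : `|zeta n w| <= M by exact: G_norm.
have Geta : G eta.
  apply: G_intro; last by move=> w; exact: limn_sup_norm_le (zM w).
  apply: (@measurable_fun_limn_sup _ (g_sigma_algebraType C) R setT zeta).
  - by move=> w _; exact: bounded_has_ubound (zM w).
  - by move=> w _; exact: bounded_has_lbound (zM w).
  - by move=> n; exact: (Gz n).1.
exists eta => // n.
apply: (@rho_countable_subadditive _ _ _ _ hrho hcont _
  (fun k w => `|zeta (n + k)%N w - zeta (n + k).+1%N w|)).
- by apply: bm_norm; apply: bm_sub; exact: G_bm.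
- by move=> k; apply: bm_norm; apply: bm_sub; exact: G_bm.
- by [].
- move=> w e e0; have e2 : 0 < e / 2 by rewrite divr_gt0.
  have /cvgrPdist_le/(_ _ e2)[m _ mP] := sups_cvg (zM w).
  have [k /= kP] := sups_adherent (zM w) (n + m)%N e2.
  exists (m + k)%N.
  (* The partial sum up to [m + k] reaches a term of the sequence that lies
     within [e] of [eta w]. *)
  have tele N : `|zeta n w - zeta (n + N)%N w| <=
      \sum_(i < N) `|zeta (n + i)%N w - zeta (n + i).+1%N w|.
    elim: N => [|N IH]; first by rewrite addn0 subrr normr0 big_ord0.
    rewrite big_ord_recr /= addnS; apply: le_trans (lerD IH (lexx _)).
    by rewrite (le_trans _ (ler_normD _ _))// addrA subrK.
  have := tele (m + k)%N; have := mP (n + m)%N (leq_addl _ _).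
  have := le_sups (zM w) (leq_addr k (n + m)%N).
  have := ler_normD (zeta n w - zeta (n + m + k)%N w)
    (zeta (n + m + k)%N w - eta w).
  rewrite addrA subrK addnA => h1 h2 h3 h4; apply: (le_trans h1).
  apply: lerD h4 _; move: h3; rewrite -/(eta w) !ler_norml => /andP[].
  lra.
move=> N; apply: (@le_trans _ _ (\sum_(k < N) half ^+ (n + k))).
  by apply: ler_sum => k _; exact: dz.
exact: sum_half_le.
Qed.

Section Selection.
Context {p : (Omega -> R) -> R} (hp : control rho p).

Let energy a : R := p (fun w => a w ^+ 2).

Let energy_ge0 a : G a -> 0 <= energy a.
Proof.
by move=> Ga; apply: (control_ge0 hp) => [|w];
  [exact/bm_sqr/G_bm|exact: sqr_ge0].
Qed.

Let energy_le a : G a -> energy a <= 2 * M ^+ 2.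
Proof.
move=> Ga; have ba := bm_sqr (G_bm Ga).
apply: (le_trans (control_le hp ba (fun w => sqr_ge0 _))).
rewrite ler_wpM2l// -[leRHS](sublinear_cst hrho);
  apply: (sublinear_mono hrho) => //.
  exact: bm_cst.
by move=> w /=; rewrite -real_normK ?num_real// ler_sqr ?nnegrE ?(ltW M_gt0)//;
  exact: G_norm.
Qed.

Lemma parallelogram a b : G a -> G b ->
  p (fun w => (a w - b w) ^+ 2) =
  2 * energy a + 2 * energy b - 4 * energy (fun w => half * (a w + b w)).
Proof.
move=> Ga Gb; have [ba bb] := (G_bm Ga, G_bm Gb).
have bmid := G_bm (G_mid Ga Gb); have bsub := bm_sub ba bb.
have scale (c : R) f : 0 <= c -> bm f ->
    c * p (fun w => f w ^+ 2) = p (fun w => c * f w ^+ 2).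
  move=> c0 bf; rewrite (control_scale hp)//; first exact: bm_sqr.
  by move=> w; exact: sqr_ge0.
have bscale (c : R) f : bm f -> bm (fun w => c * f w ^+ 2).
  by move=> bf; exact/bm_scale/bm_sqr.
have c0 (c : R) (f : Omega -> R) w : 0 <= c -> 0 <= c * f w ^+ 2.
  by move=> c0; rewrite mulr_ge0// sqr_ge0.
apply/eqP; rewrite eq_sym subr_eq; apply/eqP; rewrite /energy !scale//.
rewrite -(control_add hp (bscale 2 _ ba) (bscale 2 _ bb)); try by move=> w;
  exact: c0.
rewrite -(control_add hp).
- by congr p; apply/funext => w /=; field.
- exact: bm_sqr.
- exact: (bscale 4 _ bmid).
- by move=> w; exact: sqr_ge0.
- by move=> w; exact: (c0 4 (fun w => half * (a w + b w))).
Qed.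

(** Small [p]-distance in square forces small [rho]-distance, through the
    inequality [t <= (t ^+ 2 + e ^+ 2) / (2 * e)]; dividing [(a - b)^2] by
    [4 * M ^+ 2] makes it [[0, 1]]-valued. *)
Lemma control_dist e : 0 < e -> exists2 del, 0 < del &
  forall a b, G a -> G b -> p (fun w => (a w - b w) ^+ 2) <= del ->
    rho (fun w => `|a w - b w|) <= e.
Proof.
move=> e0; pose K := 4 * M ^+ 2.
have K0 : 0 < K by rewrite mulr_gt0// exprn_gt0.
have [del del0 delP] := control_small hp (divr_gt0 (exprn_gt0 2 e0) K0).
exists (K * del); first exact: mulr_gt0.
move=> a b Ga Gb pab; have [ba bb] := (G_bm Ga, G_bm Gb).
have bab := bm_sqr (bm_sub ba bb).
have Ki0 : 0 <= K^-1 by rewrite invr_ge0 ltW.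
have unit_ab : unit_valued (fun w => K^-1 * (a w - b w) ^+ 2).
  split; first exact: bm_scale.
  move=> w; rewrite mulr_ge0 ?sqr_ge0//= mulrC ler_pdivrMr// mul1r /K.
  have := G_norm w Ga; have := G_norm w Gb; rewrite !ler_norml.
  move=> /andP[b1 b2] /andP[a1 a2]; nra.
have rho_sq : rho (fun w => (a w - b w) ^+ 2) <= e ^+ 2.
  have := delP _ unit_ab; rewrite (control_scale hp)//; last by move=> w;
    exact: sqr_ge0.
  rewrite (sublinear_scale hrho)// mulrC ler_pdivrMr// mulrC => /(_ pab).
  by rewrite mulrC ler_pM2r ?invr_gt0.
have bound w : `|a w - b w| <= (2 * e)^-1 * (a w - b w) ^+ 2 + e / 2.
  rewrite -[(_ - _) ^+ 2]real_normK ?num_real//; set t := `|_|.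
  rewrite -subr_ge0 (_ : _ - _ = (2 * e)^-1 * (t - e) ^+ 2); last first.
    by field; exact: lt0r_neq0.
  by rewrite mulr_ge0 ?sqr_ge0// invr_ge0 mulr_ge0// ltW.
have i0 : 0 <= (2 * e)^-1 by rewrite invr_ge0 mulr_ge0// ltW.
have bs := bm_scale (2 * e)^-1 bab.
apply: (le_trans (sublinear_mono hrho (bm_add bs (bm_cst (e / 2)))
  (bm_norm (bm_sub ba bb)) bound)).
apply: (le_trans (rho_add hrho bs (bm_cst _))).
rewrite (sublinear_scale hrho)// (sublinear_cst hrho (e / 2)) -lerBrDr.
rewrite (_ : e - e / 2 = (2 * e)^-1 * e ^+ 2); last by field; exact: lt0r_neq0.
by rewrite ler_wpM2l.
Qed.

(** The infima [J n] of the energy over the decreasing convex sets [near n]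
    increase to a finite [I].  For [a], [b] in [near n] of energy at most
    [I + half ^+ n], the midpoint has energy at least [J n], so the
    parallelogram identity bounds [p ((a - b)^2)] by
    [4 * (I - J n + half ^+ n)], which tends to 0. *)
Lemma rho_Cauchy_selection (near : nat -> set (Omega -> R)) :
  (forall n, near n `<=` G) -> (forall n, near n !=set0) ->
  (forall m n, (m <= n)%N -> near n `<=` near m) ->
  (forall n a b, near n a -> near n b ->
    near n (fun w => half * (a w + b w))) ->
  exists zeta, forall n, near n (zeta n) /\
    rho (fun w => `|zeta n w - zeta n.+1 w|) <= half ^+ n.
Proof.
move=> nearG near0 near_anti near_mid.
pose J n := inf [set energy a | a in near n].
have J_le n a : near n a -> J n <= energy a.
  move=> na; apply: ge_inf; last by exists a.
  by exists 0 => _ [b nb <-]; exact/energy_ge0/(nearG n).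
have J_lt n e : 0 < e -> exists2 a, near n a & energy a < J n + e.
  move=> e0.
  have [|_ [a na <-] ae] := @inf_adherent R [set energy a | a in near n] e e0.
    split; first by have [a na] := near0 n; exists (energy a), a.
    by exists 0 => _ [b nb <-]; exact/energy_ge0/(nearG n).
  by exists a.
pose I := sup (range J).
have J_sup : has_sup (range J).
  split; first by exists (J 0%N), 0%N.
  exists (2 * M ^+ 2) => _ [n _ <-]; have [a na] := near0 n.
  by apply: (le_trans (J_le _ _ na)); exact/energy_le/(nearG n).
have JI n : J n <= I by apply: (ub_le_sup J_sup.2); exists n.
have J_mono m n : (m <= n)%N -> J m <= J n.
  move=> mn; have [b nb] := near0 n; apply: lb_le_inf;
    first by exists (energy b), b.
  by move=> _ [a na <-]; apply: J_le; exact: near_anti na.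
pose D n a := near n a /\ energy a <= I + half ^+ n.
have D0 n : exists a, D n a.
  have [a na aJ] := J_lt n _ (half_gt0 n); exists a; split=> //.
  by apply: (le_trans (ltW aJ)); rewrite lerD2r JI.
have D_anti m n a : (m <= n)%N -> D n a -> D m a.
  move=> mn [na ea]; split; first exact: near_anti na.
  by apply: (le_trans ea); rewrite lerD2l half_mono.
have D_diam k : exists N, forall a b, D N a -> D N b ->
    rho (fun w => `|a w - b w|) <= half ^+ k.
  have [del del0 delP] := control_dist (half_gt0 k).
  have d8 : 0 < del / 8 by rewrite divr_gt0.
  have [N1 N1P] := half_small d8.
  have [_ [N2 _ <-] N2P] := sup_adherent d8 J_sup.
  exists (maxn N1 N2) => a b [na ea] [nb eb].
  apply: delP; [exact: nearG na|exact: nearG nb|].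
  rewrite (parallelogram (nearG _ _ na) (nearG _ _ nb)).
  have := J_le _ _ (near_mid _ _ _ na nb).
  have := J_mono _ _ (leq_maxr N1 N2).
  have := @half_mono R _ _ (leq_maxl N1 N2).
  move: N2P ea eb N1P; rewrite -/I; lra.
have [N NP] := choice D_diam; have [z zP] := choice D0.
(* The stages are made increasing, so that [z (m k)] and [z (m k.+1)] lie in the
   same set [D (N k)]. *)
pose m k := (k + \sum_(j < k.+1) N j)%N.
have kN k : (N k <= m k)%N by rewrite /m big_ord_recr /= addnA leq_addl.
have mS k : (m k <= m k.+1)%N.
  rewrite /m [X in (_ <= _ + X)%N]big_ord_recr /=.
  by apply: leq_add; [exact: leqnSn|exact: leq_addr].
exists (fun k => z (m k)) => k; split.
  by apply: near_anti (zP (m k)).1; exact: leq_addr.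
apply: NP; first exact: D_anti (zP (m k)).
by apply: D_anti (zP (m k.+1)); exact: leq_trans (mS k).
Qed.

End Selection.

Section Cost.
Context {xi : Omega -> R} (bxi : bm xi) (xiM : forall w, `|xi w| <= M).

Local Notation cost eta := (rho (fun w => (xi w - eta w) ^+ 2)).
Local Notation BC := (bounded_measurable_wrt R C).

Let alpha : R := inf [set cost eta | eta in BC].

Lemma G_bounded a : G a -> BC a.
Proof.
move=> Ga; split; first exact: Ga.1.
by apply/bounded_funE; exists M => w; exact: G_norm.
Qed.

Let bm_cost a : bm a -> bm (fun w => (xi w - a w) ^+ 2).
Proof. by move=> ba; exact/bm_sqr/bm_sub. Qed.

Lemma bounded_measurable_wrt_bm a : BC a -> bm a.
Proof. by move=> [ma ba]; split=> //; exact: measurable_wrt_sub. Qed.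

Lemma cost_lbound : has_lbound [set cost eta | eta in BC].
Proof.
exists 0 => _ [eta /bounded_measurable_wrt_bm beta <-].
by apply: (rho_ge0 hrho); [exact: bm_cost|move=> w; exact: sqr_ge0].
Qed.

(** Truncation to [[-M, M]] moves a competitor closer to [xi] everywhere. *)
Lemma truncate_cost a : BC a -> exists2 b, G b & cost b <= cost a.
Proof.
move=> BCa; pose b w := Num.max (- M) (Num.min M (a w)).
have bM w : `|b w| <= M.
  by rewrite ler_norml /b le_max lexx /= ge_max ge_min lexx /= andbT;
    have := M_gt0; lra.
have Gb : G b.
  apply: G_intro => //; apply: measurable_maxr; first exact: measurable_cst.
  by apply: measurable_minr; [exact: measurable_cst|exact: BCa.1].
exists b => //; apply: (sublinear_mono hrho).
- exact/bm_cost/bounded_measurable_wrt_bm.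
- exact/bm_cost/G_bm.
move=> w; have := xiM w; have := M_gt0; rewrite ler_norml => M0 /andP[x1 x2].
rewrite /b; case: (leP M (a w)) => aM; case: (leP (- M) _) => Ma //; nra.
Qed.

(** Convexity of the cost is what makes its sublevel sets stable under
    midpoints. *)
Lemma cost_midpoint a b : G a -> G b ->
  cost (fun w => half * (a w + b w)) <= half * (cost a + cost b).
Proof.
move=> Ga Gb; have [ca cb] := (bm_cost (G_bm Ga), bm_cost (G_bm Gb)).
have half0 : 0 <= half by rewrite invr_ge0.
apply: (@le_trans _ _
  (rho (fun w => half * ((xi w - a w) ^+ 2 + (xi w - b w) ^+ 2)))).
  apply: (sublinear_mono hrho).
  - exact/bm_scale/bm_add.
  - exact/bm_cost/G_bm/G_mid.
  - move=> w; have := sqr_ge0 (a w - b w); nra.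
rewrite (sublinear_scale hrho)//; last exact: bm_add.
by rewrite ler_wpM2l// rho_add.
Qed.

(** From [(x - b)^2 - (x - a)^2 = (2 x - a - b) (a - b)], whose first factor is
    bounded by [4 * M]. *)
Lemma cost_lipschitz a b : G a -> G b ->
  cost b <= cost a + 4 * M * rho (fun w => `|a w - b w|).
Proof.
move=> Ga Gb; have ba := bm_sub (G_bm Ga) (G_bm Gb);
  have ca := bm_cost (G_bm Ga).
have M4 : 0 <= 4 * M by rewrite mulr_ge0// ltW.
rewrite -(sublinear_scale hrho) ?bm_norm//; last exact: bm_norm.
apply: le_trans (rho_add hrho _ _) => //; last exact/bm_scale/bm_norm.
apply: (sublinear_mono hrho).
- by apply: bm_add => //; exact/bm_scale/bm_norm.
- exact/bm_cost/G_bm.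
move=> w; rewrite -lerBlDl (_ : _ - _ = (2 * xi w - a w - b w) * (a w - b w));
  last by ring.
rewrite (le_trans (ler_norm _))// normrM ler_wpM2r//.
have := G_norm w Ga; have := G_norm w Gb; have := xiM w; rewrite !ler_norml.
lra.
Qed.

Lemma cost_attained : exists2 eta, G eta & cost eta = alpha.
Proof.
pose near n a := G a /\ cost a <= alpha + half ^+ n.
have [p hp] := exists_control hrho hcont.
have near0 n : near n !=set0.
  have [|_ [a BCa <-] ca] := @inf_adherent R [set cost eta | eta in BC] _
    (half_gt0 n).
    split; last exact: cost_lbound.
    exists (cost (cst 0)), (cst 0) => //; apply: G_bounded; apply: G_intro.
      exact: measurable_cst.
    by move=> w; rewrite normr0 ltW.
  by have [b Gb cb] := truncate_cost BCa; exists b; split=> //;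
    exact: le_trans (ltW ca).
have [|m n mn a [Ga ca]|n a b [Ga ca] [Gb cb]|zeta zP] := rho_Cauchy_selection
  hp _ near0.
- by move=> n a [].
- by split=> //; apply: (le_trans ca); rewrite lerD2l half_mono.
- split; first exact: G_mid.
  by apply: (le_trans (cost_midpoint Ga Gb)); lra.
have [|n|eta Geta etaP] := @G_complete zeta.
- by move=> n; exact: (zP n).1.1.
- exact: (zP n).2.
exists eta => //; apply/le_anti/andP; split; last first.
  by apply: (ge_inf cost_lbound); exists eta => //; exact: G_bounded.
apply/ler_addgt0Pr => e e0.
have K0 : 0 < 1 + 8 * M by have := M_gt0; lra.
have [n nP] := half_small (divr_gt0 e0 K0).
have [Gz cz] := (zP n).1.
apply: (le_trans (cost_lipschitz Gz Geta)).
have := ler_wpM2l (ltW M_gt0) (etaP n).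
by move: nP cz; rewrite ler_pdivlMr//; lra.
Qed.

End Cost.

End Minimiser.

Unset Implicit Arguments.

Theorem theorem3p2 (R : realType) (d : measure_display)
    (Omega : measurableType d) (C : set (set Omega))
    (hC : is_sub_sigma_algebra C)
    (rho : (Omega -> R) -> R)
    (hrho : sublinear_operator rho)
    (hcont : continuous_from_above rho)
    (xi : Omega -> R) (hxi : bounded_measurable R Omega xi)
    (M : R) (hM : 0 < M)
    (hxiM : sup (range (fun w => `|xi w|)) <= M) :
  exists2 eta_hat : Omega -> R,
    measurable_wrt_bounded_by C M eta_hat &
    rho (fun w => (xi w - eta_hat w) ^+ 2) =
    inf [set rho (fun w => (xi w - eta w) ^+ 2)
        | eta in bounded_measurable_wrt R C].
Proof.
apply: (cost_attained hC hrho hcont hM hxi) => w.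
apply: le_trans hxiM; apply: ub_le_sup; last by exists w.
have [_ /bounded_funE[K xiK]] := hxi.
by exists K => _ [v _ <-].
Qed.
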